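(* Let $\bar x\in\mathbb{R}^n$ be a feasible point of the problem (MPCC). Suppose that $\bar x$ is an $A_\alpha$-stationary point of (MPCC) for all $\alpha\in\{0,1\}^p$. Then the following hold. (a) For each $i\in I^p$, let $C_i\subset(-\infty,0]^2$ be a closed, connected and unbounded set with $0\in C_i$. Then there exist multipliers $(\bar\eta,\bar\lambda,\bar\mu,\bar\nu)$ that satisfy the system of weak stationarity of (MPCC) at $\bar x$ and $$(\bar\mu_i\ge 0\wedge\bar\nu_i\ge 0)\ \vee\ (\bar\mu_i,\bar\nu_i)\in C_i\qquad\forall i\in I^{00}(\bar x).$$ (b) The point $\bar x$ is $P_d$-stationary for all $d\in[0,1]^p$. In particular, these stationarity conditions (a) and (b) are satisfied for local minimizers $\bar x$ of (MPCC) if MPCC-GCQ holds at $\bar x$.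
   Context: Let $f:\mathbb{R}^n\to\mathbb{R}$, $g:\mathbb{R}^n\to\mathbb{R}^l$, $h:\mathbb{R}^n\to\mathbb{R}^m$, $G,H:\mathbb{R}^n\to\mathbb{R}^p$ be differentiable functions. The mathematical program with complementarity constraints (MPCC) is: minimize $f(x)$ over $x\in\mathbb{R}^n$ subject to $g(x)\le 0$, $h(x)=0$, $G(x)\ge 0$, $H(x)\ge 0$, $G(x)^\top H(x)=0$ (inequalities componentwise). Index sets: $I^l=\{1,\dots,l\}$, $I^m=\{1,\dots,m\}$, $I^p=\{1,\dots,p\}$, $I^g(x)=\{i\in I^l: g_i(x)=0\}$, $I^{+0}(x)=\{i\in I^p: G_i(x)>0, H_i(x)=0\}$, $I^{0+}(x)=\{i\in I^p: G_i(x)=0, H_i(x)>0\}$, $I^{00}(x)=\{i\in I^p: G_i(x)=0, H_i(x)=0\}$, and for $\alpha\in\{0,1\}^p$ and $c\in\{0,1\}$, $I^{00}_{\alpha=c}(x)=\{i\in I^{00}(x): \alpha_i=c\}$. Weak stationarity: multipliers $\bar\lambda\in\mathbb{R}^l$, $\bar\eta\in\mathbb{R}^m$, $\bar\mu,\bar\nu\in\mathbb{R}^p$ satisfy the system of weak stationarity at a feasible point $\bar x$ of (MPCC) if $$\nabla f(\bar x)+\sum_{i\in I^l}\bar\lambda_i\nabla g_i(\bar x)+\sum_{i\in I^m}\bar\eta_i\nabla h_i(\bar x)-\sum_{i\in I^p}\bar\mu_i\nabla G_i(\bar x)-\sum_{i\in I^p}\bar\nu_i\nabla H_i(\bar x)=0,$$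 $\bar\lambda_i\ge 0$ for $i\in I^g(\bar x)$, $\bar\lambda_i=0$ for $i\in I^l\setminus I^g(\bar x)$, $\bar\mu_i=0$ for $i\in I^{+0}(\bar x)$, $\bar\nu_i=0$ for $i\in I^{0+}(\bar x)$. For $\alpha\in\{0,1\}^p$ and $d\in[0,1]^p$, a feasible point $\bar x$ is called - $A_\alpha$-stationary if there exist multipliers satisfying the system of weak stationarity together with $\bar\mu_i\ge 0$ for all $i\in I^{00}_{\alpha=0}(\bar x)$ and $\bar\nu_i\ge 0$ for all $i\in I^{00}_{\alpha=1}(\bar x)$; - $P_d$-stationary if there exist multipliers satisfying the system of weak stationarity together with $(\bar\mu_i\ge 0\wedge\bar\nu_i\ge 0)\vee(1-d_i)\bar\mu_i=d_i\bar\nu_i$ for all $i\in I^{00}(\bar x)$. Constraint qualification: the tangent cone to a closed set $F\subset\mathbb{R}^n$ at $\bar x\in F$ is the set of all $d\in\mathbb{R}^n$ for which there are sequences $(x_k)\subset F$, $(t_k)\subset(0,\infty)$ with $x_k\to\bar x$, $t_k\downarrow 0$, $t_k^{-1}(x_k-\bar x)\to d$. Let $\mathcal{T}_{\rm MPCC}(\bar x)$ be the tangent cone to the feasible set of (MPCC) at $\bar x$, and let $\mathcal{T}_{\rm MPCC}^{\rm lin}(\bar x)$ be the set of all $d\in\mathbb{R}^n$ with $\nabla g_i(\bar x)^\top d\le 0$ for $i\in I^g(\bar x)$; $\nabla h_i(\bar x)^\top d=0$ for $i\in I^m$; $\nabla G_i(\bar x)^\top d=0$ for $i\in I^{0+}(\bar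 x)$; $\nabla H_i(\bar x)^\top d=0$ for $i\in I^{+0}(\bar x)$; and $\nabla G_i(\bar x)^\top d\ge 0$, $\nabla H_i(\bar x)^\top d\ge 0$, $(\nabla G_i(\bar x)^\top d)(\nabla H_i(\bar x)^\top d)=0$ for $i\in I^{00}(\bar x)$. The polar cone of $C\subset\mathbb{R}^n$ is $C^\circ=\{d\in\mathbb{R}^n: d^\top y\le 0\ \forall y\in C\}$. A feasible point $\bar x$ satisfies MPCC-GCQ if $\mathcal{T}_{\rm MPCC}(\bar x)^\circ=\mathcal{T}_{\rm MPCC}^{\rm lin}(\bar x)^\circ$. *)

(* Defs.v *)
From HB Require Import structures.
From mathcomp Require Import all_boot all_order all_algebra.
From mathcomp Require Import all_classical all_reals all_analysis.

Set Implicit Arguments.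
Unset Strict Implicit.
Unset Printing Implicit Defensive.

Import Order.TTheory GRing.Theory Num.Theory.
Import numFieldNormedType.Exports.

Local Open Scope classical_set_scope.
Local Open Scope ring_scope.

Section Euclidean.
Context {R : realType} {n : nat}.

Definition dotp (u v : 'rV[R]_n) : R := \sum_(j < n) u 0 j * v 0 j.

Definition grad (phi : 'rV[R]_n -> R) (x : 'rV[R]_n) : 'rV[R]_n :=
  \row_j 'D_(delta_mx 0 j) phi x.

(* Since t k > 0, the limit t --> 0 is one from above; requiring t to be
   monotone as well would define the same cone (pass to a subsequence). *)
Definition tangent_cone (F : set 'rV[R]_n) (x : 'rV[R]_n) : set 'rV[R]_n :=
  [set d | exists (xs : nat -> 'rV[R]_n) (t : nat -> R),
     [/\ forall k, F (xs k),
         forall k, 0 < t k,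
         xs @ \oo --> x,
         t @ \oo --> 0
       & (fun k => (t k)^-1 *: (xs k - x)) @ \oo --> d]].

Definition polar (C : set 'rV[R]_n) : set 'rV[R]_n :=
  [set d | forall y, C y -> dotp d y <= 0].

End Euclidean.

(* Minimize obj x subject to
   ineq x <= 0, eqc x = 0, compG x >= 0, compH x >= 0, compG x . compH x = 0. *)
Record mpcc (R : realType) (n l m p : nat) := Mpcc {
  obj : 'rV[R]_n -> R;
  ineq : 'rV[R]_n -> 'rV[R]_l;
  eqc : 'rV[R]_n -> 'rV[R]_m;
  compG : 'rV[R]_n -> 'rV[R]_p;
  compH : 'rV[R]_n -> 'rV[R]_p }.

Section MPCC.
Context {R : realType} {n l m p : nat}.
Variable P : mpcc R n l m p.
Implicit Types x d : 'rV[R]_n.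

Definition mpcc_differentiable : Prop :=
  [/\ forall x, differentiable (obj P) x,
      forall x, differentiable (ineq P) x,
      forall x, differentiable (eqc P) x,
      forall x, differentiable (compG P) x
    & forall x, differentiable (compH P) x].

Definition feasible_set : set 'rV[R]_n :=
  [set x | [/\ forall i, ineq P x 0 i <= 0,
               eqc P x = 0,
               forall i, 0 <= compG P x 0 i,
               forall i, 0 <= compH P x 0 i
             & dotp (compG P x) (compH P x) = 0]].

Definition local_minimizer x : Prop :=
  feasible_set x /\ \forall y \near x, feasible_set y -> obj P x <= obj P y.

Definition grad_ineq x (i : 'I_l) := grad (fun y => ineq P y 0 i) x.
Definition grad_eqc x (i : 'I_m) := grad (fun y => eqc P y 0 i) x.
Definition grad_compG x (i : 'I_p) := grad (fun y => compG P y 0 i) x.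
Definition grad_compH x (i : 'I_p) := grad (fun y => compH P y 0 i) x.

Definition Ig x : set 'I_l := [set i | ineq P x 0 i = 0].
Definition Ip0 x : set 'I_p := [set i | 0 < compG P x 0 i /\ compH P x 0 i = 0].
Definition I0p x : set 'I_p := [set i | compG P x 0 i = 0 /\ 0 < compH P x 0 i].
Definition I00 x : set 'I_p := [set i | compG P x 0 i = 0 /\ compH P x 0 i = 0].

(* Binary vectors are boolean families, with 0 as false and 1 as true. *)
Definition I00eq (alpha : 'I_p -> bool) (c : bool) x : set 'I_p :=
  [set i | I00 x i /\ alpha i = c].

Definition weakly_stationary x (lambda : 'rV[R]_l) (eta : 'rV[R]_m)
    (mu nu : 'rV[R]_p) : Prop :=
  [/\ grad (obj P) x + \sum_i lambda 0 i *: grad_ineq x i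
        + \sum_i eta 0 i *: grad_eqc x i
        - \sum_i mu 0 i *: grad_compG x i
        - \sum_i nu 0 i *: grad_compH x i = 0,
      forall i, Ig x i -> 0 <= lambda 0 i,
      forall i, ~ Ig x i -> lambda 0 i = 0,
      forall i, Ip0 x i -> mu 0 i = 0
    & forall i, I0p x i -> nu 0 i = 0].

Definition A_stationary (alpha : 'I_p -> bool) x : Prop :=
  feasible_set x /\
  exists lambda eta mu nu,
    [/\ weakly_stationary x lambda eta mu nu,
        forall i, I00eq alpha false x i -> 0 <= mu 0 i
      & forall i, I00eq alpha true x i -> 0 <= nu 0 i].

Definition P_stationary (d : 'rV[R]_p) x : Prop :=
  feasible_set x /\
  exists lambda eta mu nu,
    weakly_stationary x lambda eta mu nu /\
    forall i, I00 x i ->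
      (0 <= mu 0 i /\ 0 <= nu 0 i) \/
      (1 - d 0 i) * mu 0 i = d 0 i * nu 0 i.

Definition set_stationary (C : 'I_p -> set (R * R)%type) x : Prop :=
  exists lambda eta mu nu,
    weakly_stationary x lambda eta mu nu /\
    forall i, I00 x i ->
      (0 <= mu 0 i /\ 0 <= nu 0 i) \/ C i (mu 0 i, nu 0 i).

Definition linearized_cone x : set 'rV[R]_n :=
  [set d | [/\ forall i, Ig x i -> dotp (grad_ineq x i) d <= 0,
               forall i, dotp (grad_eqc x i) d = 0,
               forall i, I0p x i -> dotp (grad_compG x i) d = 0,
               forall i, Ip0 x i -> dotp (grad_compH x i) d = 0
             & forall i, I00 x i ->
                 [/\ 0 <= dotp (grad_compG x i) d,
                     0 <= dotp (grad_compH x i) d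
                   & dotp (grad_compG x i) d * dotp (grad_compH x i) d = 0]]].

Definition MPCC_GCQ x : Prop :=
  feasible_set x /\
  polar (tangent_cone feasible_set x) = polar (linearized_cone x).

End MPCC.

Definition admissible_set {R : realType} (C : set (R * R)%type) : Prop :=
  [/\ C `<=` [set z | z.1 <= 0 /\ z.2 <= 0],
      closed C, connected C, ~ bounded_set C & C (0, 0)].

(* Main.v *)
Require Import Defs.
From mathcomp Require Import all_boot all_order all_algebra.
From mathcomp Require Import all_fingroup zify ring lra.
From mathcomp Require Import all_classical all_reals all_analysis.
Import Order.TTheory GRing.Theory Num.Theory.
Import numFieldNormedType.Exports.
Local Open Scope classical_set_scope.
Local Open Scope ring_scope.
Set Implicit Arguments.
Unset Strict Implicit.
Unset Printing Implicit Defensive.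

(* Fix multipliers z_alpha for every A_alpha and interpolate them multilinearly
   over the cube [0,1]^p.  On the face x_i = 0 only the alpha with alpha_i = 0
   contribute, so mu_i >= 0 there; on the face x_i = 1, nu_i >= 0.  For i in I00
   the curve C_i together with the nonnegative quadrant separates these two
   situations in the plane, and a Poincare-Miranda argument gives one point of
   the cube at which every (mu_i, nu_i) lies on C_i or in the quadrant; weak
   stationarity is convex, hence survives the interpolation.  As C_i is only
   connected, it is replaced by a d-chain from 0 to infinity whose index is
   a further coordinate: the discrete Poincare-Miranda theorem is applied in
   dimension 2p, and compactness lets d tend to 0.

   The discrete Poincare-Miranda theorem is proved mod 2 on the torus (Z/N)^k:
   the cup product of k cocycles depends only on their classes, and the
   cocycles given by the labels are cohomologous to the k coordinate classes,
   whose cup product is 1.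

   (b) is (a) for the rays C_i = - R_+ (d_i, 1 - d_i).  At a local minimizer
   - grad f is polar to the tangent cone, by MPCC-GCQ to the linearized cone,
   hence to the polyhedral cone contained in it that belongs to alpha; Farkas'
   lemma then yields the multipliers of A_alpha. *)

(** * Cup products on a finite torus *)

Lemma addrr_F2 (x : 'F_2) : x + x = 0.
Proof. by apply: addrr_pchar2; apply: pchar_Fp. Qed.

Section Cochains.
Variables (V : finZmodType) (k : nat) (e : 'I_k.+1 -> V).
Local Notation cochain := (V -> 'I_k.+1 -> 'F_2).
Implicit Types (x v : V) (s : {perm 'I_k.+1}) (d : cochain).

(** [d v a] is the value on the edge from [v] to [v + e a]. Closedness is tested on squares, since
    the diagonals of the triangulation carry no values. *)
Definition cocycle d :=
  forall v a b, d v a + d (v + e a) b = d v b + d (v + e b) a.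

(* A base point and an order of the directions give the simplex with vertices
   x, x + e (s 0), x + e (s 0) + e (s 1), ... *)
Definition vertex x s (j : nat) : V := x + \sum_(i < k.+1 | (i < j)%N) e (s i).

(* The cup product of the D j, evaluated on the sum of all top simplices. *)
Definition cup_number (D : 'I_k.+1 -> cochain) : 'F_2 :=
  \sum_x \sum_s \prod_j D j (vertex x s j) (s j).

Lemma vertexS x s (a : 'I_k.+1) : vertex x s a.+1 = vertex x s a + e (s a).
Proof.
rewrite /vertex (bigD1 a) //= addrCA addrC; congr (_ + _ + _).
by apply: eq_bigl => i; rewrite ltnS ltn_neqAle andbC.
Qed.

(** Unless [c = b], the partial sum up to [c] contains both or neither of the exchanged steps. *)
Lemma vertex_swap x s (a b : 'I_k.+1) (c : nat) :
  b = a.+1 :> nat -> c != b -> vertex x (tperm a b * s)%g c = vertex x s c.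
Proof.
move=> ba cb; congr (_ + _).
rewrite [LHS](reindex_inj (@perm_inj _ (tperm a b))) /=.
apply: eq_big => [i|i _]; last by rewrite permM tpermK.
by case: tpermP => // ->; move: ba cb; lia.
Qed.

(** The permutations pair off into [s] and [tperm a b * s], of opposite parity, and each pair
    contributes the same term twice. *)
Lemma sum_swap_invariant (a b : 'I_k.+1) (T : {perm 'I_k.+1} -> 'F_2) :
  a != b -> (forall s, T (tperm a b * s)%g = T s) -> \sum_s T s = 0.
Proof.
move=> ab Tab; rewrite (bigID (@odd_perm _)) /=.
rewrite (reindex_inj (mulgI (tperm a b))) /=.
under eq_big => [s|s _] do [rewrite odd_permM odd_tperm ab addTb|rewrite Tab].
exact: addrr_F2.
Qed.

Definition rot_perm : {perm 'I_k.+1} := perm (@ordS_inj k.+1).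

Lemma vertex_rot x s (j : nat) : (j <= k)%N ->
  vertex x s j.+1 = vertex (x + e (s ord0)) (rot_perm * s)%g j.
Proof.
elim: j => [|j IHj] jk.
  rewrite -[1%N]/((@ord0 k).+1) vertexS.
  by rewrite /vertex !big_pred0 ?addr0.
have jk' : (j < k.+1)%N by apply: ltnW.
rewrite -[j.+2]/((Ordinal (jk : j.+1 < k.+1)%N).+1) vertexS.
rewrite -[X in _ = vertex _ _ X]/((Ordinal jk').+1) vertexS.
rewrite /= IHj 1?ltnW // permM permE; congr (_ + e (s _)).
by apply: val_inj; rewrite /= modn_small.
Qed.

Section Slide.
Variables (D : 'I_k -> cochain) (h : V -> 'F_2).
Hypothesis Dcocycle : forall j, cocycle (D j).

(* [D] is evaluated along all edges except the [g]-th.  By the cocycle condition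
   and the exchange of two adjacent directions the gap [g] can be moved to
   either end without changing the sum; the two extreme sums agree after a
   rotation of the directions. *)
Definition gap_sum (g : 'I_k.+1) (c : nat) : 'F_2 :=
  \sum_x \sum_s h (vertex x s c)
    * \prod_j D j (vertex x s (lift g j)) (s (lift g j)).

Lemma gap_slide (a b : 'I_k.+1) (c : nat) :
  b = a.+1 :> nat -> c != b -> gap_sum a c = gap_sum b c.
Proof.
move=> ba cb; apply: eq_bigr => x _; apply/eqP; rewrite -subr_eq0.
rewrite (oppr_pchar2 (pchar_Fp (isT : prime 2))) -big_split /=; apply/eqP.
have ak : (a < k)%N by rewrite -ltnS -ba.
(* [lift a] and [lift b] agree except at [j0], where they give [b] and [a]. *)
pose j0 := Ordinal ak.
have la : lift a j0 = b by apply: val_inj; rewrite /= /bump leqnn add1n ba.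
have lb : lift b j0 = a.
  by apply: val_inj; rewrite /= /bump ba ltnn.
have lj j : j != j0 -> [/\ lift b j = lift a j, lift a j != a & lift a j != b].
  rewrite -val_eqE /= => jj0; split.
  - by apply: val_inj; rewrite /= /bump; lia.
  - by rewrite eq_sym neq_lift.
  - by rewrite -val_eqE /= /bump; lia.
have abne : a != b by rewrite -val_eqE /= ba neq_ltn ltnSn.
(* The two summands for [s] combine to common factors times the value of [D j0] along the edges [a]
   and [b] together. By the cocycle condition this value survives their exchange. *)
apply: (sum_swap_invariant abne) => s.
have E (F : 'I_k -> 'F_2) : \prod_j F j = F j0 * \prod_(j | j != j0) F j.
  by rewrite (bigD1 j0).
rewrite !E la lb (congr1 val la : bump a j0 = b) (congr1 val lb : bump b j0 = a) {E}.
have -> : \prod_(i < k | i != j0) D i (vertex x (tperm a b * s)%g (lift b i))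
            ((tperm a b * s)%g (lift b i)) =
          \prod_(i < k | i != j0) D i (vertex x s (lift a i)) (s (lift a i)).
  apply: eq_bigr => j /lj[-> na nb].
  by rewrite vertex_swap // permM tpermD // eq_sym.
have -> : \prod_(i < k | i != j0) D i (vertex x (tperm a b * s)%g (lift a i))
            ((tperm a b * s)%g (lift a i)) =
          \prod_(i < k | i != j0) D i (vertex x s (lift a i)) (s (lift a i)).
  apply: eq_bigr => j /lj[_ na nb].
  by rewrite vertex_swap // permM tpermD // eq_sym.
have -> : \prod_(i < k | i != j0) D i (vertex x s (lift b i)) (s (lift b i)) =
          \prod_(i < k | i != j0) D i (vertex x s (lift a i)) (s (lift a i)).
  by apply: eq_bigr => j /lj[->].
rewrite -!mulrDr -!mulrDl vertex_swap //; congr (_ * (_ * _)).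
rewrite !permM tpermL tpermR [X in D j0 (vertex _ _ X)]ba vertexS permM tpermL.
rewrite (@vertex_swap _ _ a b a) //.
by rewrite [X in _ = D j0 (vertex _ _ X) _ + _]ba vertexS addrC Dcocycle addrC.
Qed.

(** Starting each path at its second vertex and moving its first direction to the end turns the
    edges 1 to [k] into the edges 0 to [k - 1]. *)
Lemma gap_sum_rot (i : nat) : (i <= k)%N -> gap_sum ord0 i.+1 = gap_sum ord_max i.
Proof.
move=> ik; rewrite /gap_sum exchange_big /= [RHS]exchange_big /=.
rewrite [RHS](reindex_inj (mulgI rot_perm)) /=; apply: eq_bigr => s _.
rewrite [RHS](reindex_inj (addIr (e (s ord0)))) /=; apply: eq_bigr => x _.
rewrite vertex_rot //; congr (_ * _); apply: eq_bigr => j _.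
have -> : bump 0 j = j.+1 by [].
have -> : bump k j = j by rewrite /bump leqNgt ltn_ord.
rewrite vertex_rot 1?ltnW // permM permE; congr (D j _ (s _)).
apply: val_inj; have jk := ltn_ord j; rewrite /= /bump modn_small; lia.
Qed.

(** The gap slides down from [i] to the first edge, is rotated to the last one and slides down again
    to [i]. The vertices moved on the way are at most [i] in the first slide and above [i] in the
    second, so [h] is never evaluated at one of them. *)
Lemma gap_sum_eq (i : 'I_k.+1) : gap_sum i i.+1 = gap_sum i i.
Proof.
have down (g : 'I_k.+1) : (g <= i)%N -> gap_sum g i.+1 = gap_sum ord0 i.+1.
  case: g => g gk /=; elim: g gk => [|g IHg] gk gi.
    by congr gap_sum; apply: val_inj.
  rewrite -(IHg (ltnW gk)) 1?ltnW //; apply/esym/gap_slide => //=.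
  by rewrite eqSS neq_ltn gi orbT.
have up (g : 'I_k.+1) : (i <= g)%N -> gap_sum i i = gap_sum g i.
  case: g => g gk /=; elim: g gk => [|g IHg] gk.
    by rewrite leqn0 => /eqP i0; congr gap_sum; apply: val_inj.
  rewrite leq_eqVlt => /predU1P[ig|ig]; first by congr gap_sum; apply: val_inj.
  by rewrite (IHg (ltnW gk)) //; apply: gap_slide => //=; rewrite neq_ltn ig.
have ik : (i <= k)%N by rewrite -ltnS.
by rewrite down // (up ord_max) // gap_sum_rot.
Qed.
End Slide.

(** The coboundary of [h] contributes [h] at both ends of the [i]-th edge. These are two equal gap
    sums, which cancel mod 2. *)
Lemma cup_number_exact (D D' : 'I_k.+1 -> cochain) (i : 'I_k.+1) (h : V -> 'F_2) :
  (forall j, cocycle (D j)) -> (forall j, j != i -> D' j = D j) ->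
  (forall v a, D' i v a = D i v a + (h (v + e a) + h v)) ->
  cup_number D' = cup_number D.
Proof.
move=> cD D'D D'i.
have Dl j : D' (lift i j) = D (lift i j) by rewrite D'D // eq_sym neq_lift.
pose Dr j := D (lift i j).
rewrite -[RHS]addr0 -(addrr_F2 (gap_sum Dr h i i)).
rewrite -{1}gap_sum_eq; last by move=> j; apply: cD.
rewrite /gap_sum -!big_split /=; apply: eq_bigr => x _.
rewrite -!big_split /=; apply: eq_bigr => s _.
have E (F : 'I_k.+1 -> 'F_2) : \prod_j F j = F i * \prod_j F (lift i j).
  by rewrite (bigD1_ord i).
rewrite !E {E} D'i -vertexS -mulrDl -mulrDl; congr (_ * _).
by apply: eq_bigr => j _; rewrite Dl.
Qed.

End Cochains.

(** * The discrete Poincare-Miranda theorem *)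

(** The comparison is between natural numbers, so that a cell never wraps around the torus. *)
Definition in_cell N k (x v : 'rV['I_N.+2]_k) :=
  forall a, (x 0%R a <= v 0%R a <= (x 0%R a).+1)%N.

Section DiscretePoincareMiranda.
Variables (N k : nat).
Local Notation grid := 'rV['I_N.+2]_k.+1.
Implicit Types (x v : grid) (s : {perm 'I_k.+1}).

Definition step (a : 'I_k.+1) : grid := delta_mx 0 a.

(* The cocycle counting the crossings of the hyperplane where the [j]-th
   coordinate passes from [ord_max] to [0]. *)
Definition wrap (j : 'I_k.+1) v (a : 'I_k.+1) : 'F_2 :=
  ((a == j) && (v 0 j == ord_max))%:R.

Lemma vertex_coord x s (c : nat) (a : 'I_k.+1) :
  vertex step x s c 0 a = x 0 a + ((s^-1)%g a < c)%N%:R.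
Proof.
rewrite mxE summxE; congr (_ + _).
rewrite big_mkcond (bigD1 ((s^-1)%g a)) //= big1 => [|i ia].
  by rewrite addr0 permKV mxE !eqxx; case: ifP.
rewrite mxE eqxx /=; case: ifP => // _; case: eqP => // asi.
by move: ia; rewrite asi permK eqxx.
Qed.

(** [wrap j v a] depends on [v] only through [v 0 a], which a step in another direction leaves
    unchanged. *)
Lemma wrap_cocycle j : cocycle step (wrap j).
Proof.
move=> v a b; have [->//|ab] := eqVneq a b.
have wrapD c d : c != d -> wrap j (v + step c) d = wrap j v d.
  move=> cd; rewrite /wrap; have [<-|//] := eqVneq d j.
  by rewrite !mxE [d == c]eq_sym (negbTE cd) andbF addr0.
have ba : b != a by rewrite eq_sym.
by rewrite (wrapD _ _ ab) (wrapD _ _ ba) addrC.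
Qed.

(** A single simplex contributes: the one with all base coordinates [ord_max] and the identity order
    of directions. *)
Lemma cup_number_wrap : cup_number step wrap = 1.
Proof.
have wrap0 x s j : s j != j -> \prod_j wrap j (vertex step x s j) (s j) = 0.
  by move=> sj; rewrite (bigD1 j) //= /wrap (negbTE sj) mul0r.
have wrap1 x (j : 'I_k.+1) :
    wrap j (vertex step x 1%g j) ((1 : {perm 'I_k.+1})%g j) = (x 0 j == ord_max)%:R.
  by rewrite /wrap vertex_coord perm1 eqxx invg1 perm1 ltnn addr0.
rewrite /cup_number (bigD1 (const_mx ord_max)) //= (bigD1 1%g) //=.
rewrite [X in X + _ + _]big1 => [|j _]; last by rewrite wrap1 mxE eqxx.
rewrite [X in _ + X + _]big1 => [|s s1]; last first.
  have /existsP[j /wrap0->//] : [exists j, s j != j].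
  rewrite -negb_forall; apply: contra s1 => /forallP s1.
  by apply/eqP/permP => j; rewrite perm1; apply/eqP.
rewrite big1 ?addr0 // => x xmax; apply: big1 => s _.
have [/forallP s1|] := boolP [forall j, s j == j]; last first.
  by rewrite negb_forall => /existsP[j /wrap0].
have -> : s = 1%g by apply/permP => j; rewrite perm1; apply/eqP.
have /existsP[j xj] : [exists j, x 0 j != ord_max].
  rewrite -negb_forall; apply: contra xmax => /forallP xmax.
  by apply/eqP/rowP => j; rewrite mxE; apply/eqP.
by rewrite (bigD1 j) //= wrap1 (negbTE xj) mul0r.
Qed.

Lemma ord_maxD1 n : (ord_max : 'I_n.+2) + 1 = 0.
Proof. by apply: val_inj; rewrite /= addn1 modnn. Qed.

Lemma discrete_poincare_mirandaS (f : 'I_k.+1 -> grid -> bool) :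
    (forall j v, v 0 j = 0 -> f j v = false) ->
    (forall j v, v 0 j = ord_max -> f j v = true) ->
  exists x, forall j, exists v w, [/\ in_cell x v, in_cell x w, f j v & ~~ f j w].
Proof.
move=> f0 f1.
(* The label is read as a 0-cochain. [D j] is cohomologous to [wrap j], and [Dn] replaces the
   classes one at a time. *)
pose h j v : 'F_2 := (f j v)%:R.
pose D j v a := wrap j v a + (h j (v + step a) + h j v).
pose Dn n (j : 'I_k.+1) := if (j < n)%N then D j else wrap j.
have cD n j : cocycle step (Dn n j).
  rewrite /Dn; case: ifP => _; last exact: wrap_cocycle.
  move=> v a b; have E := wrap_cocycle j v a b.
  rewrite /D [v + step b + _]addrAC.
  rewrite [LHS](_ : _ = (wrap j v a + wrap j (v + step a) b) +
    (h j (v + step a) + h j (v + step a)) + (h j (v + step a + step b) + h j v));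
    last by ring.
  rewrite [RHS](_ : _ = (wrap j v b + wrap j (v + step b) a) +
    (h j (v + step b) + h j (v + step b)) + (h j (v + step a + step b) + h j v));
    last by ring.
  by rewrite E !addrr_F2.
have cupD : cup_number step D = 1.
  have <- : cup_number step (Dn k.+1) = cup_number step D.
    by do 3!apply: eq_bigr => ? _; rewrite /Dn ltn_ord.
  suff cupDn n : (n <= k.+1)%N -> cup_number step (Dn n) = 1 by apply: cupDn.
  elim: n => [|n IHn] nk; first exact: cup_number_wrap.
  rewrite -(IHn (ltnW nk)).
  apply: (@cup_number_exact _ _ _ _ _ (Ordinal nk) (h (Ordinal nk)) (cD n)).
    by move=> j; rewrite -val_eqE /Dn ltnS leq_eqVlt => /= /negbTE ->.
  by move=> v a; rewrite /Dn /= ltnSn ltnn.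
have /existsP[x /existsP[s nz]] :
    [exists x, exists s, \prod_j D j (vertex step x s j) (s j) != 0].
  apply: contraT => /existsPn nz; suff : (1 : 'F_2) = 0 by [].
  rewrite -cupD; apply: big1 => x _; apply: big1 => s _.
  by have /existsPn/(_ s) := nz x; rewrite negbK => /eqP.
have Dnz j : D j (vertex step x s j) (s j) != 0.
  by apply: contraNneq nz => Dj; rewrite (bigD1 j) //= Dj mul0r.
(* If [x 0 a] were [ord_max], the [a]-th edge would either run from the face [ord_max] to the face
   [0], where wrap and label change cancel, or stay in one of these faces, where both vanish. *)
have xmax a : x 0 a != ord_max.
  apply/eqP => xa; have := Dnz a; rewrite /D -vertexS /wrap.
  have [sa|sa] := eqVneq (s a) a.
    have sVa : (s^-1)%g a = a by rewrite -[in LHS]sa permK.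
    have -> : h a (vertex step x s a.+1) = 0.
      by rewrite /h f0 // vertex_coord sVa xa ltnSn ord_maxD1.
    have -> : h a (vertex step x s a) = 1.
      by rewrite /h f1 // vertex_coord sVa xa ltnn addr0.
    by rewrite vertex_coord sVa xa ltnn addr0 eqxx.
  have -> : h a (vertex step x s a.+1) = h a (vertex step x s a).
    have sVa : (s^-1)%g a != a by apply: contra sa => /eqP {1}<-; rewrite permKV.
    have E : ((s^-1)%g a < a.+1)%N = ((s^-1)%g a < a)%N.
      by rewrite ltnS leq_eqVlt val_eqE (negbTE sVa).
    rewrite /h; case sa' : ((s^-1)%g a < a)%N.
      by rewrite !f0 // vertex_coord ?E sa' xa ord_maxD1.
    by rewrite !f1 // vertex_coord ?E sa' xa addr0.
  by rewrite addrr_F2 addr0 eqxx.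
have cell c : in_cell x (vertex step x s c).
  move=> a; rewrite vertex_coord.
  have xa : ((x 0%R a).+1 < N.+2)%N.
    by rewrite ltn_neqAle ltn_ord andbT eqSS; have := xmax a; rewrite -val_eqE.
  case: (_ < c)%N; last by rewrite addr0 leqnn leqnSn.
  by rewrite /= modn_small // addn1 // leqnn leqnSn.
(* Without wrapping, [D j] being nonzero means that label [j] differs at the ends of the [j]-th
   edge. *)
exists x => j; have := Dnz j; rewrite /D -vertexS /wrap.
have -> : (s j == j) && (vertex step x s j 0 j == ord_max) = false.
  apply/negP => /andP[/eqP sj]; rewrite vertex_coord.
  by rewrite -{2}sj permK ltnn addr0 (negbTE (xmax j)).
rewrite add0r /h.
case fS : (f j (vertex step x s j.+1)); case fj : (f j (vertex step x s j)) => //.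
  by move=> _; exists (vertex step x s j.+1), (vertex step x s j); split=> //; rewrite fj.
by move=> _; exists (vertex step x s j), (vertex step x s j.+1); split=> //; rewrite fS.
Qed.

End DiscretePoincareMiranda.

Lemma discrete_poincare_miranda (N k : nat) (f : 'I_k -> 'rV['I_N.+2]_k -> bool) :
    (forall j (v : 'rV_k), v 0 j = 0 -> f j v = false) ->
    (forall j (v : 'rV_k), v 0 j = ord_max -> f j v = true) ->
  exists x, forall j, exists v w, [/\ in_cell x v, in_cell x w, f j v & ~~ f j w].
Proof.
case: k f => [|k] f f0 f1; last exact: discrete_poincare_mirandaS.
by exists 0 => -[].
Qed.

(** * Chains in connected sets *)

Section Chains.
Variable R : realType.

(** Reachability passes to all points of [C] at distance less than [e], so the reachable points are
    open and closed in [C]. Only the terms up to [K] form the chain; the sequence goes on inside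
    [C]. *)
Lemma connected_chain (V : normedModType R) (C : set V) (z0 z : V) (e : R) :
    connected C -> 0 < e -> C z0 -> C z ->
  exists (c : nat -> V) (K : nat), [/\ c 0%N = z0, forall s, C (c s),
    forall s, `|c s.+1 - c s| <= e & c K = z].
Proof.
move=> conC e0 Cz0 Cz; pose reach y := exists (c : nat -> V) (K : nat),
  [/\ c 0%N = z0, forall s, C (c s), forall s, `|c s.+1 - c s| <= e & c K = y].
have reach_step y y' : reach y -> C y' -> `|y' - y| < e -> reach y'.
  move=> [c [K [c0 Cc ce cK]]] Cy' yy'.
  exists (fun s => if (s <= K)%N then c s else y'), K.+1; split => //=.
  - by move=> s; case: ifP.
  - move=> s; case: ltnP => sK; first by rewrite ltnW.
    have [->|sK'] := eqVneq s K; first by rewrite leqnn cK ltW.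
    by rewrite leqNgt ltn_neqAle eq_sym sK' sK subrr normr0 ltW.
  - by rewrite ltnn.
pose B := C `&` reach.
have onbhd (A : set V) : open (\bigcup_(y in A) ball y e).
  by apply: bigcup_open => y _; apply: ball_open.
suff BC : B = C by have [_] : B z by rewrite BC.
apply: conC.
- exists z0; split=> //; exists (fun=> z0), 0%N; split=> // s.
  by rewrite subrr normr0 ltW.
- exists (\bigcup_(y in B) ball y e) => //; apply/seteqP; split=> y.
    by move=> [Cy ry]; split=> //; exists y => //; apply: ballxx.
  move=> [Cy [y' [_ ry']]]; rewrite -ball_normE /= distrC => yy'.
  by split=> //; apply: reach_step yy'.
- exists (~` \bigcup_(y in C `\` B) ball y e); first exact: open_closedC.
  apply/seteqP; split=> y.
    move=> [Cy ry]; split=> // -[y' [Cy' nB]].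
    rewrite -ball_normE /= => yy'; apply: nB; split=> //.
    exact: reach_step yy'.
  move=> [Cy nU]; apply: contrapT => nB; apply: nU.
  by exists y => //; apply: ballxx.
Qed.

Lemma pair_norm_le (z : R * R) (M : R) :
  (`|z| <= M) = (`|z.1| <= M) && (`|z.2| <= M).
Proof. by rewrite [`|z|]/(Num.norm z) /= ge_max. Qed.

Lemma unbounded_norm (V : normedModType R) (C : set V) (M : R) :
  ~ bounded_set C -> exists2 z, C z & M < `|z|.
Proof.
move=> nb; apply: contrapT => nz; apply: nb.
exists M; split; first exact: num_real.
move=> M' MM' z Cz; apply: le_trans (ltW MM'); rewrite leNgt.
by apply/negP => Mz; apply: nz; exists z.
Qed.

(* Beyond a point of [C] far from the origin the chain leaves [C] along the
   diagonal, so that in the end both coordinates are below [- M]. *)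
Lemma descending_chain (C : set (R * R)%type) (M e : R) :
    admissible_set C -> 0 < e ->
  exists (c : nat -> R * R) (K : nat), [/\ c 0%N = (0, 0),
    forall s, (`|(c s.+1).1 - (c s).1| <= e) && (`|(c s.+1).2 - (c s).2| <= e),
    forall s, ((c s).1 <= 0) && ((c s).2 <= 0),
    forall s, C (c s) \/ ((c s).1 < - M) || ((c s).2 < - M) &
    forall s, (K <= s)%N -> ((c s).1 < - M) && ((c s).2 < - M)].
Proof.
move=> [Cneg _ conC ubC C0] e0.
have [z Cz Mz] := unbounded_norm `|M| ubC.
have [c [K [c0 Cc ce cK]]] := connected_chain conC e0 C0 Cz.
have [z1 z2] := Cneg _ Cz.
have Mlt : (z.1 < - M) || (z.2 < - M).
  move: Mz; rewrite ltNge pair_norm_le negb_and -!ltNge.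
  rewrite !(ler0_norm z1) !(ler0_norm z2).
  by have := ler_norm M => ? /orP[?|?]; apply/orP; [left|right]; lra.
(* As both coordinates of [z] are nonpositive, [T] diagonal steps of size [e] push them below
   [- M]. *)
pose T := Num.bound (`|M| / e).
have TM : M < T%:R * e.
  rewrite -ltr_pdivrMr //; apply: le_lt_trans (archi_boundP _).
    by rewrite ler_pM2r ?invr_gt0 // ler_norm.
  by rewrite divr_ge0 // ltW.
pose tail (s : nat) := (z.1 - s%:R * e, z.2 - s%:R * e).
exists (fun s => if (s <= K)%N then c s else tail (s - K)%N), (K + T.+1)%N; split => //=.
- move=> s; case: ltnP => sK.
    by rewrite ltnW //; have := ce s; rewrite pair_norm_le.
  have tailS t : (`|(tail t.+1).1 - (tail t).1| <= e) && (`|(tail t.+1).2 - (tail t).2| <= e).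
    have tail_step (x y : R) : x - (y + 1) * e - (x - y * e) = - e by ring.
    by rewrite /= -natr1 !tail_step normrN gtr0_norm // lexx.
  have [->|sK'] := eqVneq s K.
    by rewrite leqnn subSnn cK; have := tailS 0%N; rewrite /= !mul0r !subr0.
  by rewrite leqNgt ltn_neqAle eq_sym sK' sK /= subSn //; apply: tailS.
- move=> s; case: ifP => _; first by have [-> ->] := Cneg _ (Cc s).
  by rewrite /=; have : 0 <= (s - K)%:R * e by [rewrite mulr_ge0 // ltW]; lra.
- move=> s; case: ifP => _; first by left.
  right; have : 0 <= (s - K)%:R * e by rewrite mulr_ge0 // ltW.
  by case/orP: Mlt => /= ? ?; apply/orP; [left|right]; lra.
- move=> s Ks.
  have -> : (s <= K)%N = false by lia.
  have : T%:R * e <= (s - K)%:R * e by rewrite ler_pM2r // ler_nat; lia.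
  by rewrite /=; lra.
Qed.
End Chains.

(** * Crossing the curves in the cube *)

Section CellArithmetic.
Variables (R : realFieldType) (d : R).
Implicit Types A g x y u v : R.

(** [A] stands for a value of [a] or [b] and [g] for a chain coordinate. Each varies by at most [d]
    within a cell. *)
Lemma dist_shift A A' g g' : `|A - A'| <= d -> `|g - g'| <= d ->
  `|A + 9 * d - g - (A' + 9 * d - g')| <= 2 * d.
Proof.
move=> AA gg; rewrite (_ : _ - _ = (A - A') - (g - g')); last by ring.
by rewrite (le_trans (ler_normB _ _)) // mulr2n mulrDl mul1r lerD.
Qed.

Lemma dist_gtr0 x y : `|y - x| <= 2 * d -> 0 < y -> - (2 * d) <= x.
Proof. by rewrite ler_norml => /andP[_]; lra. Qed.

Lemma dist_max0 A g : 0 < d -> `|g| <= d -> - (2 * d) <= A + 9 * d - g ->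
  `|A - Num.max A 0| <= 16 * d.
Proof.
move=> d0; rewrite ler_norml => /andP[g0 g1] Ag.
case: (leP A 0) => A0; last by rewrite subrr normr0; lra.
by rewrite subr0 ler0_norm; lra.
Qed.

Lemma dist_unshift A g : 0 < d -> `|A + 9 * d - g| <= 6 * d -> `|A - g| <= 16 * d.
Proof. by move=> d0; rewrite !ler_norml => /andP[? ?]; apply/andP; split; lra. Qed.

Lemma dist_far A g M : 0 < d -> 16 * d <= 1 ->
  `|A + 9 * d - g| <= 6 * d -> `|A| <= M -> - (M + 1) <= g.
Proof. by move=> d0 d1; rewrite !ler_norml => /andP[? ?] /andP[? ?]; lra. Qed.

Lemma dist_order x y u v : `|u - x| <= 2 * d -> `|v - y| <= 2 * d ->
  (9 * d <= v) || (u <= v) -> (7 * d <= y) || (x <= y + 4 * d).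
Proof.
rewrite !ler_norml => /andP[? ?] /andP[? ?].
by case/orP=> ?; apply/orP; [left|right]; lra.
Qed.

Lemma dist_min x y u v : `|u - x| <= 2 * d -> `|v - y| <= 2 * d ->
  (u <= 0) || (v <= 0) -> (x <= 2 * d) || (y <= 2 * d).
Proof.
rewrite !ler_norml => /andP[? ?] /andP[? ?].
by case/orP=> ?; apply/orP; [left|right]; lra.
Qed.

(** The coordinate that is at most [2 * d] is below [7 * d], so the order condition bounds the other
    one by [2 * d + 4 * d]. *)
Lemma corner_bound x y :
    0 < d -> - (2 * d) <= x -> - (2 * d) <= y -> (x <= 2 * d) || (y <= 2 * d) ->
    (7 * d <= y) || (x <= y + 4 * d) -> (7 * d <= x) || (y <= x + 4 * d) ->
  (`|x| <= 6 * d) && (`|y| <= 6 * d).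
Proof.
move=> d0 x0 y0 /orP xy /orP yx /orP xy'; rewrite !ler_norml.
by case: xy => ?; case: yx => ?; case: xy' => ?; apply/andP; split; apply/andP; split; lra.
Qed.

End CellArithmetic.

Section Crossing.
Variables (R : realType) (p : nat) (C : 'I_p -> set (R * R)%type).
Hypothesis admC : forall i, admissible_set (C i).

Definition unit_cube : set 'rV[R]_p := [set x | forall i, 0 <= x 0 i <= 1].

Definition quadrant : set (R * R)%type := [set z | 0 <= z.1 /\ 0 <= z.2].

Variables (a b : 'rV[R]_p -> 'I_p -> R) (L : R).
Hypothesis L0 : 0 <= L.
Hypothesis lip : forall (x y : 'rV[R]_p) (t : R), unit_cube x -> unit_cube y -> 0 <= t ->
  (forall i, `|x 0 i - y 0 i| <= t) ->
  forall i, (`|a x i - a y i| <= L * t) && (`|b x i - b y i| <= L * t).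
Hypothesis a_face : forall x i, unit_cube x -> x 0 i = 0 -> 0 <= a x i.
Hypothesis b_face : forall x i, unit_cube x -> x 0 i = 1 -> 0 <= b x i.

Lemma face_pair_bound :
  exists M : R, forall x i, unit_cube x -> (`|a x i| <= M) && (`|b x i| <= M).
Proof.
have cube0 : unit_cube 0 by move=> i; rewrite mxE lexx ler01.
exists (\sum_i (`|a 0 i| + `|b 0 i|) + L) => x i cx.
have : `|a 0 i| + `|b 0 i| <= \sum_i (`|a 0 i| + `|b 0 i|).
  by rewrite (bigD1 i) //= lerDl sumr_ge0 // => j _; rewrite addr_ge0.
have /andP[] : (`|a x i - a 0 i| <= L * 1) && (`|b x i - b 0 i| <= L * 1).
  apply: lip => // j; rewrite mxE subr0 ger0_norm; by case/andP: (cx j).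
have := ler_normD (a x i - a 0 i) (a 0 i); have := ler_normD (b x i - b 0 i) (b 0 i).
rewrite !subrK; have := normr_ge0 (a 0 i); have := normr_ge0 (b 0 i).
move: (`|a x i|) (`|b x i|) (`|a 0 i|) (`|b 0 i|) (`|a x i - a 0 i|) (`|b x i - b 0 i|) => *; lra.
Qed.

Lemma approx_crossing (e : R) : 0 < e ->
  exists2 x, unit_cube x & forall i, exists2 z, (quadrant `|` C i) z &
    (`|a x i - z.1| <= e) && (`|b x i - z.2| <= e).
Proof.
move=> e0; have [M Mab] := face_pair_bound.
have [d [d0 de d1]] : exists d : R, [/\ 0 < d, 16 * d <= e & 16 * d <= 1].
  exists (Num.min e 1 / 16).
  have -> : 16 * (Num.min e 1 / 16) = Num.min e 1 by rewrite mulrC divfK.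
  rewrite !ge_min !lexx orbT; split=> //.
  by rewrite divr_gt0 // lt_min e0 ltr01.
have /choice[cK cKP] : forall i, exists cK : (nat -> R * R) * nat, [/\ cK.1 0%N = (0, 0),
    forall s, (`|(cK.1 s.+1).1 - (cK.1 s).1| <= d) && (`|(cK.1 s.+1).2 - (cK.1 s).2| <= d),
    forall s, ((cK.1 s).1 <= 0) && ((cK.1 s).2 <= 0),
    forall s, C i (cK.1 s) \/ ((cK.1 s).1 < - (M + 1)) || ((cK.1 s).2 < - (M + 1)) &
    forall s, (cK.2 <= s)%N -> ((cK.1 s).1 < - (M + 1)) && ((cK.1 s).2 < - (M + 1))].
  move=> i; have [c [K H]] := descending_chain (M + 1) (admC i) d0.
  by exists (c, K).
pose T := Num.bound (L / d).
(* [T] makes the mesh so fine that [a] and [b] change by at most [d] in a cell; the sum lets every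
   chain reach its far end at [ord_max]. *)
pose N := (\sum_i (cK i).2 + T)%N.
have KN i : ((cK i).2 <= N)%N by rewrite /N (bigD1 i) //=; lia.
have LN : L * N.+1%:R^-1 <= d.
  rewrite ler_pdivrMr ?ltr0n // mulrC -ler_pdivrMr //.
  apply: le_trans (ltW (archi_boundP _)) _; first by rewrite divr_ge0 // ltW.
  by rewrite ler_nat -/T /N; lia.
pose X (v : 'rV['I_N.+2]_(p + p)) : 'rV[R]_p :=
  \row_i ((v 0 (lshift p i))%:R / N.+1%:R).
pose c i (v : 'rV['I_N.+2]_(p + p)) := (cK i).1 (v 0 (rshift p i)).
have cubeX v : unit_cube (X v).
  move=> i; rewrite mxE divr_ge0 //= ler_pdivrMr ?ltr0n // mul1r ler_nat -ltnS.
  exact: ltn_ord.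
(* The first p grid coordinates give a point of the cube, the last p ones
   positions on the chains.  The shift by [9 * d] makes [u], resp. [w], clearly
   positive on a face [x_i = 0], resp. [x_i = 1], so that the labels imposed on
   these faces do not create spurious cells. *)
pose u (v : 'rV['I_N.+2]_(p + p)) i := a (X v) i + 9 * d - (c i v).1.
pose w (v : 'rV['I_N.+2]_(p + p)) i := b (X v) i + 9 * d - (c i v).2.
(* In a cell where [phi] changes, [u] and [w] are nearly equal; where [psi] changes away from the
   start of the chain, their minimum is near 0. Together this puts the shifted pair near the chain
   point. *)
pose phi i (v : 'rV['I_N.+2]_(p + p)) := (v 0 (lshift p i) == ord_max) ||
  (v 0 (lshift p i) != 0) && (u v i <= w v i).
pose psi i (v : 'rV['I_N.+2]_(p + p)) := (v 0 (rshift p i) != 0) && (0 < u v i) && (0 < w v i).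
pose f (j : 'I_(p + p)) (v : 'rV['I_N.+2]_(p + p)) :=
  match fintype.split j with inl i => phi i v | inr i => psi i v end.
have [||x cell] := @discrete_poincare_miranda N (p + p) f.
- move=> j v; rewrite /f; case: fintype.splitP => i ji.
    have -> : j = lshift p i by apply: val_inj.
    by move=> v0; rewrite /phi v0.
  have -> : j = rshift p i by apply: val_inj.
  by move=> v0; rewrite /psi v0.
- move=> j v; rewrite /f; case: fintype.splitP => i ji.
    have -> : j = lshift p i by apply: val_inj.
    by move=> v0; rewrite /phi v0 eqxx.
  have -> : j = rshift p i by apply: val_inj.
  move=> v0; rewrite /psi /u /w /c v0 /=.
  have [_ _ _ _ /(_ N.+1 (leqW (KN i)))] := cKP i.
  have := Mab _ i (cubeX v); rewrite !ler_norml => ? ?.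
  by apply/andP; split; lra.
exists (X x) => // i.
have cellX v : in_cell x v -> forall i, `|X v 0 i - X x 0 i| <= N.+1%:R^-1.
  move=> xv k; rewrite !mxE -mulrBl normrM [X in _ * X]gtr0_norm ?invr_gt0 ?ltr0n //.
  rewrite ler_piMl ?invr_ge0 ?ler0n //.
  have /andP[le1 le2] := xv (lshift p k).
  by rewrite -natrB // ger0_norm // (ler_nat _ _ 1); lia.
have cell_ab v : in_cell x v ->
    (`|a (X v) i - a (X x) i| <= d) && (`|b (X v) i - b (X x) i| <= d).
  have N0 : 0 <= N.+1%:R^-1 :> R by rewrite invr_ge0 ler0n.
  move=> xv; have /andP[ad bd] := lip (cubeX v) (cubeX x) N0 (cellX _ xv) i.
  by rewrite (le_trans ad) // (le_trans bd).
have cell_c v : in_cell x v ->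
    (`|(c i v).1 - (c i x).1| <= d) && (`|(c i v).2 - (c i x).2| <= d).
  move=> xv; have /andP := xv (rshift p i); rewrite /c.
  move: (v 0 (rshift p i) : nat) (x 0 (rshift p i) : nat) => m k [km mk].
  have [->|mk'] := eqVneq m k; first by rewrite !subrr normr0 ltW.
  have -> : m = k.+1 by lia.
  by have [_ /(_ k)] := cKP i.
have cell_uw v : in_cell x v ->
    (`|u v i - u x i| <= 2 * d) && (`|w v i - w x i| <= 2 * d).
  move=> xv; have := cell_ab v xv; have := cell_c v xv.
  by move=> /andP[c1 c2] /andP[a1 b1]; rewrite /u /w !dist_shift.
have [v1 [v0 [xv1 xv0]]] := cell (lshift p i).
have [w1 [w0 [xw1 xw0]]] := cell (rshift p i).
rewrite /f !(unsplitK (inl i)) !(unsplitK (inr i)).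
have /andP[uw1 ww1] := cell_uw w1 xw1; have /andP[uw0 ww0] := cell_uw w0 xw0.
have /andP[uv1 wv1] := cell_uw v1 xv1; have /andP[uv0 wv0] := cell_uw v0 xv0.
have [_ _ _ Cc _] := cKP i.
move=> /andP[/andP[_ uw1p] ww1p].
have uxp := dist_gtr0 uw1 uw1p; have wxp := dist_gtr0 ww1 ww1p.
rewrite /psi -andbA negb_and negbK.
(* If [psi] fails only because the chain starts here, the chain point is near the origin and the
   pair is almost in the quadrant. *)
case: (eqVneq (w0 0 (rshift p i)) 0) => [w00 _ _ _|_ /= ].
  have := cell_c w0 xw0; rewrite [c i w0]/c w00 /=.
  have [-> _ _ _ _] := cKP i; rewrite /= !sub0r !normrN => /andP[c1 c2].
  exists (Num.max (a (X x) i) 0, Num.max (b (X x) i) 0).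
    by left; rewrite /quadrant /= !le_max lexx !orbT.
  by rewrite /= (le_trans (dist_max0 d0 c1 uxp) de) (le_trans (dist_max0 d0 c2 wxp) de).
rewrite negb_and -!leNgt => minx.
have ge9 (A g : R) : 0 <= A -> g <= 0 -> 9 * d <= A + 9 * d - g.
  by move=> A0 g0; rewrite addrAC lerDr subr_ge0 (le_trans g0).
have cneg v : ((c i v).1 <= 0) && ((c i v).2 <= 0).
  by have [_ _ /(_ (v 0 (rshift p i)))] := cKP i.
have X0 (v : 'rV['I_N.+2]_(p + p)) : v 0 (lshift p i) = 0 -> 9 * d <= u v i.
  move=> v00; have /andP[c1 _] := cneg v; apply: ge9 => //.
  by apply: a_face => //; rewrite mxE v00 mul0r.
have X1 (v : 'rV['I_N.+2]_(p + p)) : v 0 (lshift p i) = ord_max -> 9 * d <= w v i.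
  move=> v00; have /andP[_ c2] := cneg v; apply: ge9 => //.
  by apply: b_face => //; rewrite mxE v00 divff ?pnatr_eq0.
rewrite /phi negb_or negb_and negbK -ltNge => phi1 phi0.
(* A label is either a true comparison or imposed on a face, where the shift makes the larger side
   at least [9 * d]. *)
have {phi1} phi1 : (9 * d <= w v1 i) || (u v1 i <= w v1 i).
  by case/orP: phi1 => [/eqP/X1 ->//|/andP[_ ->]]; rewrite orbT.
have {phi0} phi0 : (9 * d <= u v0 i) || (w v0 i <= u v0 i).
  by case/andP: phi0 => _ /orP[/eqP/X0 ->//|/ltW->]; rewrite orbT.
have /andP[uxd wxd] := corner_bound d0 uxp wxp (dist_min uw0 ww0 minx)
  (dist_order uv1 wv1 phi1) (dist_order wv0 uv0 phi0).
exists (c i x); last first.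
  by rewrite (le_trans (dist_unshift d0 uxd) de) (le_trans (dist_unshift d0 wxd) de).
(* A chain point outside [C i] has a coordinate below [- (M + 1)], too far from a pair bounded by
   [M]. *)
right; have [//|/orP far] := Cc (x 0 (rshift p i)).
have /andP[aM bM] := Mab _ i (cubeX x).
have := dist_far d0 d1 uxd aM; have := dist_far d0 d1 wxd bM.
by rewrite !leNgt => /negbTE c2 /negbTE c1; case: far; rewrite /c in c1 c2; rewrite ?c1 ?c2.
Qed.

Lemma closed_quadrant : closed quadrant.
Proof.
have -> : quadrant = (fst @^-1` [set y | 0 <= y]) `&` (snd @^-1` [set y | 0 <= y]).
  by [].
apply: closedI; apply: closed_comp (@closed_ge R 0) => z _.
  exact: cvg_fst.
exact: cvg_snd.
Qed.

Lemma unit_cube_compact : compact unit_cube.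
Proof.
have -> : unit_cube = [set v | forall i, (`[0, 1]%classic : set R) (v ord0 i)].
  by apply/seteqP; split=> x cx i; have := cx i; rewrite /= in_itv.
by apply: (@rV_compact R p (fun=> `[0, 1]%classic)) => _; apply: segment_compact.
Qed.

(** The approximate crossings cluster in the compact cube; as the target sets are closed and [a],
    [b] are Lipschitz, a cluster point is an exact crossing. *)
Lemma crossing : exists2 x, unit_cube x &
  forall i, (quadrant `|` C i) (a x i, b x i).
Proof.
have /choice[xs xsP] : forall k : nat, exists x, unit_cube x /\ forall i,
    exists2 z, (quadrant `|` C i) z &
      (`|a x i - z.1| <= k.+1%:R^-1) && (`|b x i - z.2| <= k.+1%:R^-1).
  move=> k; have [|x cx xP] := @approx_crossing k.+1%:R^-1; last by exists x.
  by rewrite invr_gt0 ltr0n.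
have [|x [cx clx]] := @unit_cube_compact (xs @ \oo).
  by exists 0%N => // k _; have [] := xsP k.
exists x => // i; have clS : closed (quadrant `|` C i).
  by apply: closedU; [exact: closed_quadrant|have [] := admC i].
apply: contrapT => nS.
have /nbhs_ballP[r /= r0 rS] : nbhs (a x i, b x i) (~` (quadrant `|` C i)).
  by apply: open_nbhs_nbhs; split=> //; apply: closed_openC.
have L1 : 0 < L + 1 by rewrite ltr_wpDl.
pose t := r / 2 / (L + 1).
have t0 : 0 < t by rewrite !divr_gt0.
have Lt : L * t < r / 2.
  by rewrite /t mulrA ltr_pdivrMr // mulrC ltr_pM2l ?divr_gt0 // ltrDl.
pose k0 := Num.bound (r / 2)^-1.
have [y [[k kk0 <-] xky]] : (xs @` [set k | (k0 <= k)%N]) `&` ball x t !=set0.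
  apply: clx; last exact: nbhsx_ballx.
  by exists k0 => // k k0k; exists k.
have [cxk /(_ i)[z Sz /andP[az bz]]] := xsP k.
have kr : k.+1%:R^-1 < r / 2.
  rewrite invf_plt ?posrE ?ltr0n ?divr_gt0 //.
  apply: lt_le_trans (archi_boundP _) _; first by rewrite invr_ge0 divr_ge0 // ltW.
  by rewrite ler_nat; apply: leqW.
have /andP[aL bL] : (`|a x i - a (xs k) i| <= L * t) && (`|b x i - b (xs k) i| <= L * t).
  apply: lip => // [|j]; first exact: ltW.
  by have [_ /(_ 0 j)] := xky; rewrite -ball_normE => /ltW.
apply: (rS z) => //.
have near (u v w : R) : `|u - v| <= L * t -> `|v - w| <= k.+1%:R^-1 -> ball u r w.
  move=> uv vw; rewrite -ball_normE /ball_ /= -[u](subrK v) -addrA.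
  rewrite (le_lt_trans (ler_normD _ _)) // [ltRHS]splitr.
  by rewrite ltrD // ?(le_lt_trans uv) ?(le_lt_trans vw).
by split; [apply: near aL az|apply: near bL bz].
Qed.

End Crossing.

(** * From A-stationarity to set- and P-stationarity *)

Section Multilinear.
Variables (R : realType) (p : nat).
Implicit Types (alpha : {ffun 'I_p -> bool}) (x y : 'rV[R]_p).

(** This is the probability of [alpha] when its entries are independent and entry [i] is true with
    probability [x 0 i]. *)
Definition vertex_weight alpha x : R :=
  \prod_i (if alpha i then x 0 i else 1 - x 0 i).

Lemma vertex_weight_ge0 alpha x : unit_cube x -> 0 <= vertex_weight alpha x.
Proof.
move=> cx; apply: prodr_ge0 => i _; have /andP[? ?] := cx i.
by case: ifP; rewrite ?subr_ge0.
Qed.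

Lemma sum_vertex_weight x : \sum_alpha vertex_weight alpha x = 1.
Proof.
rewrite /vertex_weight -(bigA_distr_bigA (fun i (c : bool) => if c then x 0 i else 1 - x 0 i)).
by apply: big1 => i _; rewrite big_bool /= addrC subrK.
Qed.

Lemma vertex_weight_face0 alpha x i :
  x 0 i = 0 -> alpha i -> vertex_weight alpha x = 0.
Proof. by move=> xi ai; rewrite /vertex_weight (bigD1 i) //= ai xi mul0r. Qed.

Lemma vertex_weight_face1 alpha x i :
  x 0 i = 1 -> ~~ alpha i -> vertex_weight alpha x = 0.
Proof.
by move=> xi /negbTE ai; rewrite /vertex_weight (bigD1 i) //= ai xi subrr mul0r.
Qed.

(** Factors are exchanged one at a time, the others being bounded by 1. *)
Lemma dist_prod_le (I : Type) (s : seq I) (F G : I -> R) :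
    (forall i, 0 <= F i <= 1) -> (forall i, 0 <= G i <= 1) ->
  `|\prod_(i <- s) F i - \prod_(i <- s) G i| <= \sum_(i <- s) `|F i - G i|.
Proof.
move=> F01 G01; elim: s => [|i s IHs]; first by rewrite !big_nil subrr normr0.
rewrite !big_cons (_ : _ - _ = (F i - G i) * \prod_(j <- s) F j
  + G i * (\prod_(j <- s) F j - \prod_(j <- s) G j)); last by ring.
rewrite (le_trans (ler_normD _ _)) // !normrM lerD //.
  apply: ler_piMr => //; rewrite ger0_norm.
    by apply: prodr_ile1 => j _; apply: F01.
  by apply: prodr_ge0 => j _; case/andP: (F01 j).
apply: le_trans IHs; apply: ler_piMl => //.
by have /andP[Gi0 Gi1] := G01 i; rewrite ger0_norm.
Qed.

Lemma vertex_weight_lip alpha x y (t : R) : unit_cube x -> unit_cube y ->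
  (forall i, `|x 0 i - y 0 i| <= t) ->
  `|vertex_weight alpha x - vertex_weight alpha y| <= p%:R * t.
Proof.
move=> cx cy xy; apply: le_trans (dist_prod_le _ _ _) _.
- move=> i; have := cx i; case: ifP => _ /andP[? ?]; apply/andP; split => //.
    by rewrite subr_ge0.
  by rewrite gerBl.
- move=> i; have := cy i; case: ifP => _ /andP[? ?]; apply/andP; split => //.
    by rewrite subr_ge0.
  by rewrite gerBl.
apply: le_trans (_ : \sum_(i < p) t <= _); last first.
  by rewrite sumr_const card_ord mulr_natl.
apply: ler_sum => i _; case: ifP => _ //.
by rewrite (_ : _ - _ = y 0 i - x 0 i); [rewrite distrC|ring].
Qed.

Lemma vertex_weight_comb_lip (z : {ffun 'I_p -> bool} -> R) (M : R) x y (t : R) :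
    unit_cube x -> unit_cube y -> 0 <= t -> (forall i, `|x 0 i - y 0 i| <= t) ->
    \sum_alpha `|z alpha| <= M ->
  `|\sum_alpha vertex_weight alpha x * z alpha
    - \sum_alpha vertex_weight alpha y * z alpha| <= M * p%:R * t.
Proof.
move=> cx cy t0 xy zM; rewrite -sumrB.
apply: le_trans (ler_norm_sum _ _ _) _.
apply: le_trans (_ : \sum_alpha `|z alpha| * (p%:R * t) <= _); last first.
  by rewrite -mulr_suml -mulrA ler_wpM2r // mulr_ge0.
apply: ler_sum => alpha _; rewrite -mulrBl normrM mulrC ler_wpM2l //.
exact: vertex_weight_lip.
Qed.

End Multilinear.

Section Stationarity.
Variables (R : realType) (n l m p : nat) (P : mpcc R n l m p) (x : 'rV[R]_n).

Lemma sum_comb_scale (I : finType) (k : nat) (w : I -> R) (v : I -> 'rV[R]_k)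
    (g : 'I_k -> 'rV[R]_n) :
  \sum_i (\sum_a w a *: v a) 0 i *: g i = \sum_a w a *: \sum_i v a 0 i *: g i.
Proof.
under eq_bigr => i _ do rewrite summxE scaler_suml.
rewrite exchange_big; apply: eq_bigr => a _; rewrite scaler_sumr.
by apply: eq_bigr => i _; rewrite mxE scalerA.
Qed.

Lemma weakly_stationary_convex (I : finType) (w : I -> R) lambda eta mu nu :
    (forall a, 0 <= w a) -> \sum_a w a = 1 ->
    (forall a, weakly_stationary P x (lambda a) (eta a) (mu a) (nu a)) ->
  weakly_stationary P x (\sum_a w a *: lambda a) (\sum_a w a *: eta a)
    (\sum_a w a *: mu a) (\sum_a w a *: nu a).
Proof.
move=> w0 w1 ws.
have comb k (v : I -> 'rV[R]_k) i : (\sum_a w a *: v a) 0 i = \sum_a w a * v a 0 i.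
  by rewrite summxE; apply: eq_bigr => a _; rewrite mxE.
split.
- rewrite !sum_comb_scale -[grad _ _]scale1r -w1 scaler_suml.
  rewrite -!big_split -!sumrB; apply: big1 => a _ /=.
  by rewrite -!scalerDr -!scalerBr; have [-> _ _ _ _] := ws a; rewrite scaler0.
- move=> i Ii; rewrite comb; apply: sumr_ge0 => a _; rewrite mulr_ge0 //.
  by have [_ + _ _ _] := ws a; apply.
- move=> i Ii; rewrite comb; apply: big1 => a _.
  by have [_ _ -> //] := ws a; rewrite mulr0.
- move=> i Ii; rewrite comb; apply: big1 => a _.
  by have [_ _ _ -> //] := ws a; rewrite mulr0.
- move=> i Ii; rewrite comb; apply: big1 => a _.
  by have [_ _ _ _ -> //] := ws a; rewrite mulr0.
Qed.

Lemma A_stationary_set_stationary (C : 'I_p -> set (R * R)%type) :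
    (forall alpha, A_stationary P alpha x) -> (forall i, admissible_set (C i)) ->
  set_stationary P C x.
Proof.
move=> Ax admC.
have /choice[z zP] : forall alpha : {ffun 'I_p -> bool},
    exists z : 'rV[R]_l * 'rV[R]_m * 'rV[R]_p * 'rV[R]_p,
    [/\ weakly_stationary P x z.1.1.1 z.1.1.2 z.1.2 z.2,
        forall i, I00eq P alpha false x i -> 0 <= z.1.2 0 i
      & forall i, I00eq P alpha true x i -> 0 <= z.2 0 i].
  move=> alpha; have [_ [la [et [mu [nu H]]]]] := Ax alpha.
  by exists (la, et, mu, nu).
pose W (k : nat) (y : 'rV[R]_p) (v : {ffun 'I_p -> bool} -> 'rV[R]_k) :=
  \sum_alpha vertex_weight alpha y *: v alpha.
have WE k y v i : W k y v 0 i = \sum_alpha vertex_weight alpha y * v alpha 0 i.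
  by rewrite summxE; apply: eq_bigr => alpha _; rewrite mxE.
pose mu alpha := (z alpha).1.2; pose nu alpha := (z alpha).2.
(* Sign information is available only on [I00]; elsewhere the value 0 meets the face conditions. *)
pose a y i := if `[< I00 P x i >] then W p y mu 0 i else 0.
pose b y i := if `[< I00 P x i >] then W p y nu 0 i else 0.
pose M := \sum_i \sum_alpha (`|mu alpha 0 i| + `|nu alpha 0 i|).
have M0 : 0 <= M by do 2!apply: sumr_ge0 => ? _; rewrite addr_ge0.
have muM i : \sum_alpha `|mu alpha 0 i| <= M.
  rewrite /M (bigD1 i) //= -[leLHS]addr0 lerD //.
    by apply: ler_sum => alpha _; rewrite lerDl.
  by do 2!apply: sumr_ge0 => ? _; rewrite addr_ge0.
have nuM i : \sum_alpha `|nu alpha 0 i| <= M.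
  rewrite /M (bigD1 i) //= -[leLHS]addr0 lerD //.
    by apply: ler_sum => alpha _; rewrite lerDr.
  by do 2!apply: sumr_ge0 => ? _; rewrite addr_ge0.
have [||||y cy yS] := @crossing R p C admC a b (M * p%:R).
- by rewrite mulr_ge0.
- move=> y y' t cy cy' t0 yy' i; rewrite /a /b; case: asboolP => Ii.
    by rewrite !WE !vertex_weight_comb_lip.
  by rewrite !subrr normr0 !mulr_ge0.
- move=> y i cy yi; rewrite /a; case: asboolP => // Ii; rewrite WE.
  apply: sumr_ge0 => alpha _; case ai: (alpha i).
    by rewrite (vertex_weight_face0 yi) // mul0r.
  by rewrite mulr_ge0 ?vertex_weight_ge0 //; have [_ + _] := zP alpha; apply.
- move=> y i cy yi; rewrite /b; case: asboolP => // Ii; rewrite WE.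
  apply: sumr_ge0 => alpha _; case ai: (alpha i); last first.
    by rewrite (vertex_weight_face1 yi) ?ai // mul0r.
  by rewrite mulr_ge0 ?vertex_weight_ge0 //; have [_ _] := zP alpha; apply.
exists (W _ y (fun alpha => (z alpha).1.1.1)), (W _ y (fun alpha => (z alpha).1.1.2)),
  (W _ y mu), (W _ y nu); split.
  apply: weakly_stationary_convex; last by move=> alpha; have [] := zP alpha.
    by move=> alpha; apply: vertex_weight_ge0.
  exact: sum_vertex_weight.
by move=> i Ii; have := yS i; rewrite /a /b asboolT.
Qed.

Definition down_ray (d : R) : set (R * R)%type :=
  [set z | [/\ z.1 <= 0, z.2 <= 0 & (1 - d) * z.1 = d * z.2]].

Lemma down_ray_admissible (d : R) : 0 <= d <= 1 -> admissible_set (down_ray d).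
Proof.
move=> /andP[d0 d1].
pose f (t : R) : R * R := (- (d * t), - ((1 - d) * t)).
have rayE : down_ray d = f @` `[0, +oo[.
  apply/seteqP; split=> [[z1 z2] [/= z10 z20 zE]|_ [t /= t0 <-]].
    (* The weights [d] and [1 - d] add up to 1, so the parameter is minus the sum of the
       coordinates. *)
    exists (- (z1 + z2)); first by rewrite /= in_itv /= andbT; lra.
    by rewrite /f; congr (_, _); lra.
  move: t0; rewrite in_itv /= andbT => t0; split=> /=.
  - by rewrite oppr_le0 mulr_ge0.
  - by rewrite oppr_le0 mulr_ge0 // subr_ge0.
  - by ring.
split.
- by move=> z [].
- have -> : down_ray d = (fst @^-1` [set y | y <= 0]) `&` (snd @^-1` [set y | y <= 0])
      `&` ((fun z : R * R => (1 - d) * z.1 - d * z.2) @^-1` [set y | y = 0]).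
    apply/seteqP; split=> z; first by move=> [? ? /= ->]; rewrite subrr.
    by move=> [[? ?] /= /eqP]; rewrite subr_eq0 => /eqP.
  apply: closedI; first apply: closedI.
  + by apply: closed_comp (@closed_le R 0) => z _; apply: cvg_fst.
  + by apply: closed_comp (@closed_le R 0) => z _; apply: cvg_snd.
  + apply: closed_comp (@closed_eq R 0) => z _.
    by apply: cvgB; apply: cvgM; (exact: cvg_cst || exact: cvg_fst || exact: cvg_snd).
- rewrite rayE; apply: connected_continuous_connected.
    by apply/connected_intervalP; apply: interval_is_interval.
  apply: continuous_subspaceT => t.
  apply: (@cvg_pair _ _ _ (nbhs t) (nbhs _) (nbhs _) _ _ _
    (fun t => - (d * t)) (fun t => - ((1 - d) * t))).
    by apply: cvgN; apply: cvgM; [exact: cvg_cst|exact: cvg_id].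
  by apply: cvgN; apply: cvgM; [exact: cvg_cst|exact: cvg_id].
- move=> [M [_ /(_ (`|M| + 1))]].
  have MM : M < `|M| + 1 by rewrite (le_lt_trans (ler_norm M)) // ltrDl.
  (* The absolute values of the coordinates of this point add up to its parameter, hence cannot both
     be at most [|M| + 1]. *)
  move=> /(_ MM) /(_ (f (2 * (`|M| + 2)))).
  have t0 : 0 <= 2 * (`|M| + 2) by rewrite mulr_ge0 // addr_ge0.
  have ray : down_ray d (f (2 * (`|M| + 2))).
    by rewrite rayE; exists (2 * (`|M| + 2)) => //=; rewrite in_itv /= andbT.
  move=> /(_ ray); rewrite [X in X -> _]/= pair_norm_le /= !normrN.
  have d1' : 0 <= 1 - d by rewrite subr_ge0.
  rewrite (ger0_norm (mulr_ge0 d0 t0)) (ger0_norm (mulr_ge0 d1' t0)).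
  by move=> /andP[? ?]; have := normr_ge0 M; lra.
- by split => //=; rewrite !mulr0.
Qed.

Lemma set_stationary_P_stationary (d : 'rV[R]_p) : feasible_set P x ->
  set_stationary P (fun i => down_ray (d 0 i)) x -> P_stationary P d x.
Proof.
move=> feas [la [et [mu [nu [ws H]]]]]; split=> //; exists la, et, mu, nu; split=> //.
by move=> i /H[|[_ _]]; [left|right].
Qed.

End Stationarity.

(** * Farkas' lemma and local minimizers *)

Section Farkas.
Variables (R : realType) (n : nat).
Implicit Types (u v c d : 'rV[R]_n).

Lemma dotpDl u v d : dotp (u + v) d = dotp u d + dotp v d.
Proof. by rewrite -big_split; apply: eq_bigr => j _; rewrite mxE mulrDl. Qed.

Lemma dotpZl (k : R) u d : dotp (k *: u) d = k * dotp u d.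
Proof. by rewrite mulr_sumr; apply: eq_bigr => j _; rewrite mxE mulrA. Qed.

Lemma dotpC u v : dotp u v = dotp v u.
Proof. by apply: eq_bigr => j _; rewrite mulrC. Qed.

Lemma dotpNl u d : dotp (- u) d = - dotp u d.
Proof. by rewrite -scaleN1r dotpZl mulN1r. Qed.

Lemma dotpBl u v d : dotp (u - v) d = dotp u d - dotp v d.
Proof. by rewrite dotpDl dotpNl. Qed.

Lemma dotpBr d u v : dotp d (u - v) = dotp d u - dotp d v.
Proof. by rewrite !(dotpC d) dotpBl. Qed.

Lemma dotpZr (k : R) d u : dotp d (k *: u) = k * dotp d u.
Proof. by rewrite !(dotpC d) dotpZl. Qed.

Lemma dotp_eq0 c : (forall d, dotp c d <= 0) -> c = 0.
Proof.
move=> c0; apply/rowP => j; rewrite mxE; apply/eqP; rewrite -sqrf_eq0 eq_le sqr_ge0.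
rewrite andbT (le_trans _ (c0 c)) // /dotp (bigD1 j) //= -expr2 lerDl.
by apply: sumr_ge0 => i _; rewrite -expr2 sqr_ge0.
Qed.

(* Bartl's induction: if the last constraint cannot be dropped, then it is
   eliminated by projecting along a direction that violates the conclusion. *)
Lemma farkas_seq (I : eqType) (r : seq I) (a : I -> 'rV[R]_n) c : uniq r ->
    (forall d, (forall i, i \in r -> dotp (a i) d <= 0) -> dotp c d <= 0) ->
  exists2 w : I -> R, forall i, 0 <= w i & c = \sum_(i <- r) w i *: a i.
Proof.
elim: r a c => [|i r IHr] a c /=.
  move=> _ c0; exists (fun=> 0) => //; rewrite big_nil.
  by apply: dotp_eq0 => d; apply: c0.
move=> /andP[ir ur] ac.
have extend (w : I -> R) (b : I -> 'rV[R]_n) (k : R) :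
    \sum_(j <- r) (if j == i then k else w j) *: b j = \sum_(j <- r) w j *: b j.
  apply: eq_big_seq => j jr; case: eqP => // ji.
  by rewrite ji (negbTE ir) in jr.
have [rc|/existsNP[d0 /not_implyP[rd0 /negP cd0]]] := pselect
    (forall d, (forall j, j \in r -> dotp (a j) d <= 0) -> dotp c d <= 0).
  have [w w0 ->] := IHr a c ur rc.
  exists (fun j => if j == i then 0 else w j); first by move=> j; case: ifP => // _; apply: w0.
  by rewrite big_cons eqxx scale0r add0r extend.
rewrite -ltNge in cd0.
have aid0 : 0 < dotp (a i) d0.
  rewrite ltNge; apply: contraL cd0 => ai0; rewrite -leNgt; apply: ac => j.
  by rewrite inE => /predU1P[->//|/rd0].
pose e := (dotp (a i) d0)^-1 *: d0.
have aie : dotp (a i) e = 1 by rewrite dotpZr mulVf // gt_eqF.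
have re j : j \in r -> dotp (a j) e <= 0.
  by move=> /rd0 aj; rewrite dotpZr mulr_ge0_le0 // invr_ge0 ltW.
have ce : 0 < dotp c e by rewrite dotpZr mulr_gt0 ?invr_gt0.
clearbody e.
(* [proj v] vanishes on [e]; dually, [d] is moved along [e] into the hyperplane orthogonal to
   [a i]. *)
pose proj v := v - dotp v e *: a i.
have projE v d : dotp (proj v) d = dotp v (d - dotp (a i) d *: e).
  by rewrite dotpBl dotpZl dotpBr dotpZr mulrC.
have [d rd|w w0 cE] := IHr (fun j => proj (a j)) (proj c) ur.
  rewrite projE; apply: ac => j; rewrite inE => /predU1P[->|jr].
    by rewrite dotpBr dotpZr aie mulr1 subrr.
  by rewrite -projE rd.
exists (fun j => if j == i then dotp c e - \sum_(k <- r) w k * dotp (a k) e else w j).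
  move=> j; case: ifP => // _; rewrite subr_ge0 (le_trans _ (ltW ce)) //.
  rewrite big_seq; apply: sumr_le0 => k kr.
  by rewrite mulr_ge0_le0 // re.
rewrite big_cons eqxx extend -[LHS](subrK (dotp c e *: a i)) -/(proj c) cE.
under eq_bigr do rewrite scalerBr scalerA.
by rewrite sumrB -scaler_suml scalerBl addrC [RHS]addrAC addrA.
Qed.

(** Each index gives the rows [a i] and [- a i], set to zero when the inequality is absent. An
    equation lies in both predicates and has a free multiplier. *)
Lemma farkas (I : finType) (a : I -> 'rV[R]_n) (le0 ge0 : pred I) c :
    (forall d, (forall i, le0 i -> dotp (a i) d <= 0) ->
               (forall i, ge0 i -> 0 <= dotp (a i) d) -> dotp c d <= 0) ->
  exists w : I -> R, [/\ c = \sum_i w i *: a i,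
    forall i, ~~ le0 i -> w i <= 0 & forall i, ~~ ge0 i -> 0 <= w i].
Proof.
move=> ac; pose b (ic : I * bool) : 'rV[R]_n :=
  if ic.2 then (le0 ic.1)%:R *: a ic.1 else - ((ge0 ic.1)%:R *: a ic.1).
have [|d bd|w w0 cE] := @farkas_seq _ (index_enum (I * bool)%type) b c.
- exact: index_enum_uniq.
- apply: ac => i Pi.
    by have := bd (i, true) (mem_index_enum _); rewrite /b /= Pi scale1r.
  have := bd (i, false) (mem_index_enum _).
  by rewrite /b /= Pi scale1r dotpNl oppr_le0.
exists (fun i => w (i, true) * (le0 i)%:R - w (i, false) * (ge0 i)%:R); split.
- have -> : c = \sum_i \sum_k w (i, k) *: b (i, k).
    by rewrite cE pair_bigA; apply: eq_bigr => -[].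
  apply: eq_bigr => i _; rewrite big_bool /= scalerBl.
  by rewrite /b /= scalerN !scalerA.
- by move=> i /negbTE->; rewrite mulr0 sub0r oppr_le0 mulr_ge0.
- by move=> i /negbTE->; rewrite mulr0 subr0 mulr_ge0.
Qed.

End Farkas.

(** * First-order conditions at a local minimizer *)

Section LocalMinimizer.
Variables (R : realType) (n l m p : nat) (P : mpcc R n l m p) (x : 'rV[R]_n).

Lemma linearized_polar_A_stationary (alpha : 'I_p -> bool) : feasible_set P x ->
  polar (linearized_cone P x) (- grad (obj P) x) -> A_stationary P alpha x.
Proof.
move=> feas polf; split=> //.
pose a (j : 'I_l + 'I_m + ('I_p + 'I_p)) := match j with
  | inl (inl i) => grad_ineq P x i | inl (inr i) => grad_eqc P x i
  | inr (inl i) => grad_compG P x i | inr (inr i) => grad_compH P x i end.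
(* For [i] in [I00], [alpha i = true] makes the row of [G] an equation and keeps that of [H] an
   inequality, so only [nu] gets a sign; [false] exchanges the roles. Rows in neither predicate get
   multiplier 0. *)
pose le0 (j : 'I_l + 'I_m + ('I_p + 'I_p)) := match j with
  | inl (inl i) => `[< Ig P x i >] | inl (inr i) => true
  | inr (inl i) => `[< I0p P x i \/ I00eq P alpha true x i >]
  | inr (inr i) => `[< Ip0 P x i \/ I00eq P alpha false x i >] end.
pose ge0 (j : 'I_l + 'I_m + ('I_p + 'I_p)) := match j with
  | inl (inl i) => false | inl (inr i) => true
  | inr (inl i) => `[< I0p P x i \/ I00 P x i >]
  | inr (inr i) => `[< Ip0 P x i \/ I00 P x i >] end.
have [d dle dge|w [fE wle wge]] := @farkas R n _ a le0 ge0 (- grad (obj P) x).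
  apply: polf; split.
  - by move=> i Ii; apply: (dle (inl (inl i))); apply/asboolP.
  - by move=> i; apply/eqP; rewrite eq_le (dle (inl (inr i))) // (dge (inl (inr i))).
  - move=> i Ii; apply/eqP; rewrite eq_le (dle (inr (inl i))) ?(dge (inr (inl i))) //.
      by apply/asboolP; left.
    by apply/asboolP; left.
  - move=> i Ii; apply/eqP; rewrite eq_le (dle (inr (inr i))) ?(dge (inr (inr i))) //.
      by apply/asboolP; left.
    by apply/asboolP; left.
  - move=> i Ii.
    have G0 : 0 <= dotp (grad_compG P x i) d.
      by apply: (dge (inr (inl i))); apply/asboolP; right.
    have H0 : 0 <= dotp (grad_compH P x i) d.
      by apply: (dge (inr (inr i))); apply/asboolP; right.
    split=> //; apply/eqP; rewrite mulf_eq0 !eq_le G0 H0 !andbT.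
    case ai: (alpha i); apply/orP; [left|right].
      by apply: (dle (inr (inl i))); apply/asboolP; right.
    by apply: (dle (inr (inr i))); apply/asboolP; right.
have disjoint i : I00 P x i -> ~ I0p P x i /\ ~ Ip0 P x i.
  by move=> [G0 H0]; split=> -[]; rewrite ?G0 ?H0 ?ltxx.
exists (\row_i w (inl (inl i))), (\row_i w (inl (inr i))),
  (\row_i - w (inr (inl i))), (\row_i - w (inr (inr i))).
split; last first.
- move=> i [Ii ai]; rewrite mxE oppr_ge0; apply: wle; apply/asboolPn => -[|[_]].
    by have [_] := disjoint i Ii.
  by rewrite ai.
- move=> i [Ii ai]; rewrite mxE oppr_ge0; apply: wle; apply/asboolPn => -[|[_]].
    by have [] := disjoint i Ii.
  by rewrite ai.
split.
- apply/eqP; rewrite -!addrA addrC addr_eq0 fE !big_sumType /= -!addrA; apply/eqP.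
  congr (_ + (_ + _)).
  + by apply: eq_bigr => i _; rewrite mxE.
  + by apply: eq_bigr => i _; rewrite mxE.
  rewrite -!sumrN; congr (_ + _); apply: eq_bigr => i _; by rewrite mxE scaleNr opprK.
- by move=> i Ii; rewrite mxE; apply: wge.
- move=> i Ii; rewrite mxE; apply/eqP; rewrite eq_le wge // wle //.
  exact/asboolPn.
- move=> i [Gi Hi]; have G0 : compG P x 0 i <> 0 by move=> G0; rewrite G0 ltxx in Gi.
  rewrite mxE; apply/eqP; rewrite oppr_eq0 eq_le wge ?wle //.
    by apply/asboolPn => -[[]|[[]]].
  by apply/asboolPn => -[[]|[]].
- move=> i [Gi Hi]; have H0 : compH P x 0 i <> 0 by move=> H0; rewrite H0 ltxx in Hi.
  rewrite mxE; apply/eqP; rewrite oppr_eq0 eq_le wge ?wle //.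
    by apply/asboolPn => -[[]|[[]]].
  by apply/asboolPn => -[[]|[]].
Qed.

Lemma dotp_grad (f : 'rV[R]_n -> R) (d : 'rV[R]_n) :
  differentiable f x -> dotp (grad f x) d = 'd f x d.
Proof.
move=> df; rewrite [in RHS](row_sum_delta d) linear_sum; apply: eq_bigr => j _.
by rewrite linearZ /= mxE deriveE // mulrC.
Qed.

(** Minimality along [xs] and the first-order expansion with error [e] times the distance are
    divided by [t k]; the limit gives [approx], with [e] arbitrary. *)
Lemma local_minimizer_tangent_polar : differentiable (obj P) x ->
  local_minimizer P x -> polar (tangent_cone (feasible_set P) x) (- grad (obj P) x).
Proof.
move=> df [feas minf] d [xs [t [Fxs t0 xsx _ wd]]].
rewrite dotpNl oppr_le0 dotp_grad //.
pose w k := (t k)^-1 *: (xs k - x).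
have approx (e : R) : 0 < e -> 0 <= 'd (obj P) x d + e * `|d|.
  move=> e0.
  have lim : 'd (obj P) x (w k) + e * `|w k| @[k --> \oo] --> 'd (obj P) x d + e * `|d|.
    apply: cvgD.
      apply: continuous_cvg wd; exact: diff_continuous.
    by apply: cvgM; [exact: cvg_cst|exact: cvg_norm].
  apply: ler_cvg_to (@cvg_cst _ (0 : R) _ _ _) lim _.
  have /eqaddoP /(_ _ e0) small := diff_locally df.
  have xs0 : xs k - x @[k --> \oo] --> (0 : 'rV[R]_n).
    by rewrite -(subrr x); apply: cvgB => //; exact: cvg_cst.
  have minxs : \forall k \near \oo, feasible_set P (xs k) -> obj P x <= obj P (xs k).
    exact: xsx _ minf.
  have smallxs : \forall k \near \oo,
      `|obj P (xs k) - obj P x - 'd (obj P) x (xs k - x)| <= e * `|xs k - x|.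
    have := xs0 _ small; rewrite /nbhs /=. apply: filterS => k /=.
    by rewrite !fctE /= subrK opprD addrA.
  near=> k.
  have fk : obj P x <= obj P (xs k).
    by move: (Fxs k); near: k.
  have : `|obj P (xs k) - obj P x - 'd (obj P) x (xs k - x)| <= e * `|xs k - x|.
    by near: k.
  rewrite ler_norml => /andP[_ le].
  have : 0 <= 'd (obj P) x (xs k - x) + e * `|xs k - x| by move: le fk; lra.
  rewrite -(pmulr_rge0 _ (_ : 0 < (t k)^-1)) ?invr_gt0 // mulrDr.
  by rewrite /w linearZ /= normrZ gtr0_norm ?invr_gt0 // mulrCA.
rewrite leNgt; apply/negP => d0.
have B : 0 < `|d| + 1 by rewrite ltr_wpDl.
(* With this [e] the error absorbs at most half of the negative derivative. *)
have e0 : 0 < - 'd (obj P) x d / 2 / (`|d| + 1) by rewrite !divr_gt0 // oppr_gt0.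
have := approx _ e0.
have : - 'd (obj P) x d / 2 / (`|d| + 1) * `|d| <= - 'd (obj P) x d / 2.
  by rewrite mulrAC ler_pdivrMr // ler_pM2l ?divr_gt0 ?oppr_gt0 // lerDl.
by move: d0; lra.
Unshelve. all: by end_near. Qed.

End LocalMinimizer.

Theorem theorem4p2 (R : realType) (n l m p : nat) (P : mpcc R n l m p)
    (xbar : 'rV[R]_n) (diffP : mpcc_differentiable P)
    (feas : feasible_set P xbar) :
  ((forall alpha : 'I_p -> bool, A_stationary P alpha xbar) ->
     (forall C : 'I_p -> set (R * R)%type,
        (forall i, admissible_set (C i)) -> set_stationary P C xbar) /\
     (forall d : 'rV[R]_p,
        (forall i, 0 <= d 0 i <= 1) -> P_stationary P d xbar)) /\
  (local_minimizer P xbar -> MPCC_GCQ P xbar ->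
     (forall C : 'I_p -> set (R * R)%type,
        (forall i, admissible_set (C i)) -> set_stationary P C xbar) /\
     (forall d : 'rV[R]_p,
        (forall i, 0 <= d 0 i <= 1) -> P_stationary P d xbar)).
Proof.
have main : (forall alpha : 'I_p -> bool, A_stationary P alpha xbar) ->
    (forall C : 'I_p -> set (R * R)%type,
       (forall i, admissible_set (C i)) -> set_stationary P C xbar) /\
    (forall d : 'rV[R]_p, (forall i, 0 <= d 0 i <= 1) -> P_stationary P d xbar).
  move=> Ax; split=> [C admC|d d01]; first exact: A_stationary_set_stationary.
  apply: set_stationary_P_stationary => //.
  apply: A_stationary_set_stationary => // i; exact: down_ray_admissible.
split=> // minx [_ gcq]; apply: main => alpha.
apply: linearized_polar_A_stationary => //; rewrite -gcq.
by apply: local_minimizer_tangent_polar => //; have [dobj _ _ _ _] := diffP.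
Qed.
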